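(* Rational-valued probabilistic Turing machines ($\mathbb{Q}$PTMs) and probabilistic two-stack pushdown automata (2PDA) are strongly equivalent: for every $\mathbb{Q}$PTM $\mathcal{M}$ there exists a 2PDA $\mathcal{P}$ strongly equivalent to $\mathcal{M}$, and for every 2PDA $\mathcal{P}$ there exists a $\mathbb{Q}$PTM $\mathcal{M}$ strongly equivalent to $\mathcal{P}$.
   Context: Alphabets are finite non-empty sets of symbols. $\varepsilon$ is the empty string, $\varepsilon\notin\Sigma$, and $\Sigma_\varepsilon = \Sigma\cup\{\varepsilon\}$, $\Gamma_\varepsilon=\Gamma\cup\{\varepsilon\}$. A $\mathbb{Q}$PTM is a two-tape machine $\mathcal{M}=(Q,\Sigma,\Gamma,\delta,q_\iota,q_\varphi)$, where $Q$ is a finite set of states, $\Sigma$ is the (output) alphabet, $\Gamma$ is the tape alphabet containing the blank symbol $\sqcup$, $q_\iota,q_\varphi\in Q$ are the initial and final states, and $\delta: Q\times\Gamma\times\Sigma_\varepsilon\times Q\times\Gamma\times\{L,R,N\}\to\mathbb{Q}_{\ge 0}$ is a transition weighting function with $\sum_{y\in\Sigma_\varepsilon,\,q'\in Q,\,\gamma'\in\Gamma,\,d\in\{L,R,N\}}\delta\big((q,\gamma)\xrightarrow{y/d}(q',\gamma')\big)=1$ for all $q\in Q,\gamma\in\Gamma$. The first tape is an infinite working tape, initially all blank; the second is an append-only output tape, initially empty. The machine starts in $q_\iota$ and repeatedly samples and applies a transition with the probability given by $\delta$. A transition $(q,\gamma)\xrightarrow{y/d}(q',\gamma')$ means: in state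 $q$ reading $\gamma$ on the working tape, go to state $q'$, write $\gamma'$ to the working tape, append $y$ to the output tape (nothing if $y=\varepsilon$), and move the working-tape head left ($L$), right ($R$), or keep it in place ($N$). It halts once it reaches $q_\varphi$. A 2PDA is a two-stack machine $\mathcal{P}=(Q,\Sigma,\Gamma,\delta,q_\iota,q_\varphi)$, where $Q$ is a finite set of states, $\Sigma$ and $\Gamma$ are the input and stack alphabets, $\Gamma$ contains the bottom-of-stack symbol $\perp$, $q_\iota,q_\varphi\in Q$ are the initial and final states, and $\delta: Q\times\Gamma\times\Sigma_\varepsilon\times Q\times\Gamma_\varepsilon^4\to\mathbb{Q}_{\ge 0}$ is a transition weighting function. A transition is written $q\xrightarrow[\gamma_2\to\gamma_4]{y,\gamma,\ \gamma_1\to\gamma_3}q'$ with $q,q'\in Q$, $y\in\Sigma_\varepsilon$, $\gamma\in\Gamma$, $\gamma_1,\dots,\gamma_4\in\Gamma_\varepsilon$; it means that the 2PDA, in state $q$ with $\gamma$ on top of the first stack, pops $\gamma_1$ and $\gamma_2$ from the first and second stack respectively, pushes $\gamma_3$ and $\gamma_4$ onto the first and second stack respectively, moves to state $q'$, and emits $y$. The weighting function is locally normalized: for all $q\in Q$, $\gamma\in\Gamma$ (with $\gamma$ the symbol on top of the first stack), $\sum_{y\in\Sigma_\varepsilon,\,q'\in Q,\,\gamma_1,\gamma_2,\gamma_3,\gamma_4\in\Gamma_\varepsilon}\delta\big(q\xrightarrow[\gamma_2\to\gamma_4]{y,\gamma,\ \gamma_1\to\gamma_3}q'\big)=1$. The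 2PDA starts in $q_\iota$ with both stacks containing only $\perp$, sequentially applies transitions according to their probability given by $\delta$, and halts when reaching $q_\varphi$; its output is the concatenation of the emitted symbols. A path is a finite sequence of actions (transitions) of a model starting from its initial configuration; it is halting if it ends in the final state. Transitions of weight $0$ are treated as non-existent. The weight of a path is the product of the weights of its transitions; its yield is the string obtained by concatenating the symbols it emits. Two models are weakly equivalent if every string $\boldsymbol{y}\in\Sigma^*$ has the same probability of being the output (the sum of the weights of halting paths with yield $\boldsymbol{y}$) in both; they are strongly equivalent if, furthermore, there is a weight-preserving and yield-preserving bijection between their halting paths.
   Formalization: The 2PDA's local normalization is corrected: for each state and each pair of top symbols of both stacks, the weights of the transitions whose pops match those tops sum to 1, instead of summing over all pops; with the displayed sum the claim fails (random ww is not obtainable). *)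

(* Defs.v *)
From HB Require Import structures.
From mathcomp Require Import all_boot all_order all_algebra.
From mathcomp Require Import classical_sets reals ereal esum.

Set Implicit Arguments.
Unset Strict Implicit.
Unset Printing Implicit Defensive.

Import Order.TTheory GRing.Theory Num.Theory.

Local Open Scope ring_scope.

(* The empty string [varepsilon] is [None], so X_epsilon is [option X]. *)

(** * Weighted models emitting strings over [S], their paths and equivalences *)

(* [step c a] is [None] when the action [a] is not possible in [c]. *)
Record model (S : Type) : Type := Model {
  config : Type;
  action : finType;
  start  : config;
  step   : config -> action -> option config;
  final  : config -> bool;
  weight : action -> rat;
  emit   : action -> option S
}.

(* A model halts as soon as it is in a final configuration, so no action is
   possible there; actions of weight 0 are non-existent. *)
Fixpoint run (S : Type) (A : model S) (c : config A) (p : seq (action A)) :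
    option (config A) :=
  if p is a :: p' then
    if final c || (weight a == 0) then None
    else if step c a is Some c' then run c' p' else None
  else Some c.

Definition halting (S : Type) (A : model S) (p : seq (action A)) : bool :=
  if run (start A) p is Some c then final c else false.

Definition path_weight (S : Type) (A : model S) (p : seq (action A)) : rat :=
  \prod_(a <- p) weight a.

Definition path_yield (S : Type) (A : model S) (p : seq (action A)) : seq S :=
  pmap (@emit S A) p.

(* The sum ranges over a possibly infinite set, hence the extended reals. *)
Definition output_prob (R : realType) (S : Type) (A : model S) (y : seq S) :
    \bar R :=
  esum [set p : seq (action A) | halting p /\ path_yield p = y]%classic
       (fun p => (ratr (path_weight p) : R)%:E).

Definition weakly_equivalent (R : realType) (S : Type) (A B : model S) : Prop :=
  forall y : seq S, output_prob R A y = output_prob R B y.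

Definition halting_path (S : Type) (A : model S) : Type :=
  {p : seq (action A) | halting p}.

Definition strongly_equivalent (R : realType) (S : Type) (A B : model S) :
    Prop :=
  weakly_equivalent R A B /\
  exists2 phi : halting_path A -> halting_path B,
    bijective phi &
    forall p, path_weight (sval (phi p)) = path_weight (sval p) /\
              path_yield (sval (phi p)) = path_yield (sval p).

(** * Rational-valued probabilistic Turing machines *)

Inductive move : Type := MoveL | MoveR | MoveN.

Definition move_code (d : move) : 'I_3 :=
  match d with
  | MoveL => inord 0
  | MoveR => inord 1
  | MoveN => inord 2
  end.

Definition move_decode (i : 'I_3) : move :=
  match val i with
  | 0%N => MoveL
  | 1%N => MoveR
  | _ => MoveN
  end.

Lemma move_codeK : cancel move_code move_decode.
Proof. by case; rewrite /move_decode /= inordK. Qed.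

HB.instance Definition _ := Finite.copy move (can_type move_codeK).

Record QPTM (S : finType) : Type := MkQPTM {
  tm_state : finType;
  tm_sym   : finType;
  tm_blank : tm_sym;
  tm_delta : tm_state -> tm_sym -> option S -> tm_state -> tm_sym -> move -> rat;
  tm_init  : tm_state;
  tm_final : tm_state;
  tm_delta_ge0 : forall q g y q' g' d, 0 <= tm_delta q g y q' g' d;
  tm_delta_sum1 : forall q g,
    \sum_(y : option S) \sum_(q' : tm_state) \sum_(g' : tm_sym) \sum_(d : move)
      tm_delta q g y q' g' d = 1
}.

(* The working tape is infinite in both directions. *)
Record tm_config (S : finType) (M : QPTM S) : Type := TMConfig {
  tmc_state : tm_state M;
  tmc_head  : int;
  tmc_tape  : int -> tm_sym M
}.

Definition move_head (d : move) (i : int) : int :=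
  match d with
  | MoveL => i - 1
  | MoveR => i + 1
  | MoveN => i
  end.

Definition tm_trans (S : finType) (M : QPTM S) : finType :=
  (tm_state M * tm_sym M * option S * tm_state M * tm_sym M * move)%type.

Definition tm_step (S : finType) (M : QPTM S) (c : tm_config M)
    (t : tm_trans M) : option (tm_config M) :=
  let: (q, g, y, q', g', d) := t in
  if (tmc_state c == q) && (tmc_tape c (tmc_head c) == g) then
    Some (TMConfig q' (move_head d (tmc_head c))
            (fun i => if i == tmc_head c then g' else tmc_tape c i))
  else None.

Definition QPTM_model (S : finType) (M : QPTM S) : model S :=
  {| config := tm_config M;
     action := tm_trans M;
     start  := TMConfig (tm_init M) 0 (fun _ => tm_blank M);
     step   := @tm_step S M;
     final  := fun c => tmc_state c == tm_final M;
     weight := fun t => let: (q, g, y, q', g', d) := t in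
                        tm_delta q g y q' g' d;
     emit   := fun t => let: (q, g, y, q', g', d) := t in y |}.

(** * Probabilistic two-stack pushdown automata *)

(* [x] can be popped from a stack whose top symbol is [top]. *)
Definition can_pop (G : eqType) (top : G) (x : option G) : bool :=
  if x is Some a then a == top else true.

(* Local normalization: whenever [g] is on top of the first stack (and [h] on
   top of the second), the weights of the transitions that are possible sum
   to 1.  A transition whose pop does not match a stack top is not possible.
   If the sum also counted the transitions popping other symbols than [h] from
   the second stack, then in a 2PDA that halts with probability 1 no reachable
   pop could fail, so that the second stack would have no influence on the
   output: such automata would not be equivalent to Turing machines.
   In [pda_delta q g y q' g1 g2 g3 g4], the transition pops [g1], [g2] from and
   pushes [g3], [g4] onto the first and second stack. *)
Record twoPDA (S : finType) : Type := MkTwoPDA {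
  pda_state : finType;
  pda_sym   : finType;
  pda_bot   : pda_sym;
  pda_delta : pda_state -> pda_sym -> option S -> pda_state ->
              option pda_sym -> option pda_sym ->
              option pda_sym -> option pda_sym -> rat;
  pda_init  : pda_state;
  pda_final : pda_state;
  pda_delta_ge0 : forall q g y q' g1 g2 g3 g4,
    0 <= pda_delta q g y q' g1 g2 g3 g4;
  pda_delta_sum1 : forall q g h,
    \sum_(y : option S) \sum_(q' : pda_state)
    \sum_(g1 : option pda_sym | can_pop g g1)
    \sum_(g2 : option pda_sym | can_pop h g2)
    \sum_(g3 : option pda_sym) \sum_(g4 : option pda_sym)
      pda_delta q g y q' g1 g2 g3 g4 = 1
}.

(* Stacks are listed from top to bottom. *)
Record pda_config (S : finType) (P : twoPDA S) : Type := PDAConfig {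
  pdac_state  : pda_state P;
  pdac_stack1 : seq (pda_sym P);
  pdac_stack2 : seq (pda_sym P)
}.

Definition pop (G : eqType) (x : option G) (s : seq G) : option (seq G) :=
  match x, s with
  | None, _ => Some s
  | Some a, b :: s' => if a == b then Some s' else None
  | Some _, [::] => None
  end.

Definition push (G : Type) (x : option G) (s : seq G) : seq G :=
  if x is Some a then a :: s else s.

Definition pda_trans (S : finType) (P : twoPDA S) : finType :=
  (pda_state P * pda_sym P * option S * pda_state P *
   option (pda_sym P) * option (pda_sym P) *
   option (pda_sym P) * option (pda_sym P))%type.

Definition pda_step (S : finType) (P : twoPDA S) (c : pda_config P)
    (t : pda_trans P) : option (pda_config P) :=
  let: (q, g, y, q', g1, g2, g3, g4) := t in
  if (pdac_state c == q) && (ohead (pdac_stack1 c) == Some g) then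
    match pop g1 (pdac_stack1 c), pop g2 (pdac_stack2 c) with
    | Some s1, Some s2 => Some (PDAConfig q' (push g3 s1) (push g4 s2))
    | _, _ => None
    end
  else None.

Definition twoPDA_model (S : finType) (P : twoPDA S) : model S :=
  {| config := pda_config P;
     action := pda_trans P;
     start  := PDAConfig (pda_init P) [:: pda_bot P] [:: pda_bot P];
     step   := @pda_step S P;
     final  := fun c => pdac_state c == pda_final P;
     weight := fun t => let: (q, g, y, q', g1, g2, g3, g4) := t in
                        pda_delta q g y q' g1 g2 g3 g4;
     emit   := fun t => let: (q, g, y, q', g1, g2, g3, g4) := t in y |}.

(* Main.v *)
Require Import Defs.
From HB Require Import structures.
From mathcomp Require Import all_boot all_order all_algebra.
From mathcomp Require Import reals.
From mathcomp Require Import boolp classical_sets functions ereal esum zify.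

(** Each machine simulates the other so that every probabilistic transition is
    sampled by exactly one transition of the same weight and yield, all further
    transitions of the simulator being forced, of weight 1 and without output.
    Every transition of the simulator then determines, whatever the
    configuration, either the transition it samples or nothing; erasing the
    latter kind maps halting paths of the simulator bijectively to halting paths
    of the simulated machine.

    A 2PDA simulates a Turing machine step by step: the scanned symbol is in the
    state, the two stacks are the two sides of the tape.  A Turing machine holds
    the two stacks on the two sides of the origin, tops outwards.  For each
    transition of the 2PDA it reads the first top, walks to the second one,
    samples, updates the second stack, walks back and updates the first. *)

Set Implicit Arguments.
Unset Strict Implicit.
Unset Printing Implicit Defensive.

Import Order.TTheory GRing.Theory Num.Theory.

Local Open Scope ring_scope.

(** * Simulations with forced silent steps *)

Section HaltingRuns.
Variables (S : Type) (A : model S).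
Implicit Types (c : config A) (a : action A) (p : seq (action A)).

Definition enabled c a c' : Prop :=
  [/\ ~~ final c, weight a != 0 & step c a = Some c'].

Definition halts c p : bool := if run c p is Some c' then final c' else false.

(** Covers stuck configurations and forced infinite loops alike: neither contributes a halting path,
    so a stuck automaton may be simulated by a looping machine. *)
Definition dead c : Prop := forall p, ~~ halts c p.

Lemma halts_nil c : halts c [::] = final c.
Proof. by []. Qed.

Lemma halts_consP c a p :
  halts c (a :: p) <-> exists2 c', enabled c a c' & halts c' p.
Proof.
rewrite /halts /=; split.
  have [//|fc] := boolP (final c); have [//|wa] := boolP (weight a == 0).
  by case E: (step c a) => [c'|] //= hp; exists c'.
by case=> c' [/negPf fc /negPf wa E] hp; rewrite fc wa /= E.
Qed.

Lemma enabled_fun c a c1 c2 : enabled c a c1 -> enabled c a c2 -> c1 = c2.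
Proof. by case=> _ _ E1 [_ _]; rewrite E1 => -[]. Qed.

End HaltingRuns.

Section Simulation.
Variables (S : Type) (A B : model S).
Variable dec : action B -> option (action A).
Implicit Types (c : config A) (d : config B).

(** A [model] carries no normalization, so weight 1 alone would not exclude other enabled actions;
    uniqueness is demanded separately. *)
Definition silent_step d b d' : Prop :=
  [/\ enabled d b d', forall b' d'', enabled d b' d'' -> b' = b,
      weight b = 1, emit b = None & dec b = None].

Inductive silent : config B -> config B -> Prop :=
| silent_refl d : silent d d
| silent_cons d b d' d'' : silent_step d b d' -> silent d' d'' -> silent d d''.

Lemma silent_trans d1 d2 d3 : silent d1 d2 -> silent d2 d3 -> silent d1 d3.
Proof. by elim=> // d b d' d'' s _ IH /IH; exact: silent_cons s. Qed.

(** Every configuration passed on the way is non-final and has only one enabled action, so a halting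
    path can neither stop nor branch before [d']: it begins with the same prefix [s]. *)
Lemma silent_halts d d' : silent d d' ->
  exists s, [/\ path_weight s = 1, path_yield s = [::], pmap dec s = [::] &
    forall p, halts d p <-> exists2 p', p = s ++ p' & halts d' p'].
Proof.
elim=> {d d'} [d|d b d' d'' [en uniq wb eb db] _ [s [ws ys ds hs]]].
  exists [::]; split=> //; first by rewrite /path_weight big_nil.
  by move=> p; split=> [hp|[p' ->]//]; exists p.
exists (b :: s); split.
- by rewrite /path_weight big_cons wb mul1r.
- by rewrite /path_yield /= eb.
- by rewrite /= db.
case=> [|b' p]; split.
- by rewrite halts_nil; case: en => /negPf ->.
- by case.
- case/halts_consP=> d1 en1; have E := uniq _ _ en1; subst b'.
  rewrite (enabled_fun en1 en) => /hs[p' -> hp']; exists p' => //.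
- case=> p' [-> ->] hp'; apply/halts_consP; exists d' => //.
  by apply/hs; exists p'.
Qed.

Lemma silent_loop_dead d b : silent_step d b d -> dead d.
Proof.
case=> en uniq _ _ _; elim=> [|b' p IH]; first by case: en.
apply/negP => /halts_consP[d' en']; have E := uniq _ _ en'; subst b'.
by rewrite (enabled_fun en' en); apply/negP.
Qed.

Variable R : config A -> config B -> Prop.

(** The forward clause of [BothStep] allows a dead end because the simulator may sample a transition
    that the simulated machine cannot execute. The last clause is what makes decoding injective. *)
Variant matching c d : Prop :=
| BothFinal of final c & final d
| BothDead of dead c & dead d
| BothStep of ~~ final c & ~~ final d
    & (forall b d', enabled d b d' -> dead d' \/
        exists a c', [/\ dec b = Some a, weight b = weight a, emit b = emit a,
                         enabled c a c' & R c' d'])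
    & (forall a c', enabled c a c' ->
        exists b d', [/\ dec b = Some a, enabled d b d' & R c' d'])
    & (forall b1 b2 d1 d2, enabled d b1 d1 -> enabled d b2 d2 ->
        dec b1 = dec b2 -> b1 = b2).

Hypothesis R_matching : forall c d, R c d ->
  exists2 d', silent d d' & matching c d'.

Definition decode (p : seq (action B)) : seq (action A) := pmap dec p.

Lemma decode_halts c d p : R c d -> halts d p ->
  [/\ halts c (decode p), path_weight (decode p) = path_weight p &
      path_yield (decode p) = path_yield p].
Proof.
(* Strong induction on the length: one round removes a silent prefix of unknown length together with
   one sampling action. *)
have [n] := ubnP (size p); elim: n => // n IH in c d p *.
move=> sz /R_matching[d' /silent_halts[s [ws ys ds hs]] m] /hs[q Ep hq].
have {}sz : (size q < n.+1)%N by move: sz; rewrite Ep size_cat; lia.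
have {Ep}[-> -> ->] : [/\ decode p = decode q, path_weight p = path_weight q &
    path_yield p = path_yield q].
  rewrite Ep /decode /path_weight /path_yield !pmap_cat big_cat /=.
  by rewrite -/(path_weight s) -/(path_yield s) ws ys ds mul1r.
case: m => [fc fd|dc dd|fc fd fwd _ _].
- case: q hq {sz} => [|b q] hq; last by case/halts_consP: hq => ? [/negP nf].
  by rewrite /path_weight !big_nil.
- by case/negP: (dd q).
case: q => [|b q] in hq sz *; first by rewrite halts_nil (negPf fd) in hq.
have /halts_consP[d1 en hq1] := hq.
case: (fwd _ _ en) => [dd|[a [c' [db wb eb enc Rc]]]].
  by case/negP: (dd q).
have [h w y] := IH _ _ _ (sz : (size q < n)%N) Rc hq1.
rewrite /decode /path_weight /path_yield /= db /= eb !big_cons wb.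
rewrite -/(decode q) -/(path_weight q) -/(path_yield q) -w -y; split=> //.
by apply/halts_consP; exists c'.
Qed.

Lemma decode_surj c d p : R c d -> halts c p ->
  exists2 q, halts d q & decode q = p.
Proof.
elim: p c d => [|a p IH] c d /R_matching[d' /silent_halts[s [_ _ ds hs]] m] hp.
  case: m => [fc fd|dc dd|fc fd _ _ _].
  - exists s; last by [].
    by apply/hs; exists [::]; rewrite ?cats0.
  - by case/negP: (dc [::]).
  - by rewrite halts_nil (negPf fc) in hp.
have /halts_consP[c' en hp'] := hp.
case: m => [fc fd|dc dd|fc fd _ bwd _].
- by case: en => /negP nf.
- by case/negP: (dc (a :: p)).
have [b [d1 [db enb Rc]]] := bwd _ _ en.
have [q hq Eq] := IH _ _ Rc hp'.
exists (s ++ b :: q); last by rewrite /decode pmap_cat ds /= db /= -Eq.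
by apply/hs; exists (b :: q) => //; apply/halts_consP; exists d1.
Qed.

(** Both paths share the forced prefix. Being halting, they avoid dead ends, so their next actions
    decode to something; equal decodings give equal actions, hence a common successor. *)
Lemma decode_inj c d p1 p2 : R c d -> halts d p1 -> halts d p2 ->
  decode p1 = decode p2 -> p1 = p2.
Proof.
have [n] := ubnP (size p1); elim: n => // n IH in c d p1 p2 *.
move=> sz /R_matching[d' /silent_halts[s [_ _ ds hs]] m].
move=> /hs[q1 Ep1 hq1] /hs[q2 Ep2 hq2]; subst p1 p2.
rewrite /decode !pmap_cat ds /= => E; congr (_ ++ _).
case: m => [fc fd|dc dd|fc fd fwd _ inj].
- case: q1 q2 hq1 hq2 {E sz} => [|b1 q1] [|b2 q2] //.
  + by move=> _ /halts_consP[? [/negP]].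
  + by move=> /halts_consP[? [/negP]].
  + by move=> /halts_consP[? [/negP]].
- by case/negP: (dd q1).
case: q1 => [|b1 q1] in hq1 sz E *; first by rewrite halts_nil (negPf fd) in hq1.
case: q2 => [|b2 q2] in hq2 E *; first by rewrite halts_nil (negPf fd) in hq2.
have /halts_consP[d1 en1 h1] := hq1; have /halts_consP[d2 en2 h2] := hq2.
case: (fwd _ _ en1) => [dd|[a1 [c1 [db1 _ _ enc1 R1]]]].
  by case/negP: (dd q1).
case: (fwd _ _ en2) => [dd|[a2 [c2 [db2 _ _ enc2 R2]]]].
  by case/negP: (dd q2).
move: E; rewrite /= db1 db2 /= => -[Ea E].
have Eb : b1 = b2 by apply: inj en1 en2 _; rewrite db1 db2 Ea.
subst b2; congr cons; rewrite -(enabled_fun en1 en2) in h2.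
apply: IH R1 h1 h2 E; move: sz; rewrite size_cat /=; lia.
Qed.

Lemma simulation_strongly_equivalent (K : realType) :
  R (start A) (start B) -> strongly_equivalent K A B.
Proof.
move=> R0; split.
  move=> y; rewrite /output_prob.
  rewrite (reindex_esum [set p | halting p /\ path_yield p = y]%classic
            [set p | halting p /\ path_yield p = y]%classic decode).
    apply: eq_esum => p [hp _].
    by have [_ -> _] := decode_halts R0 hp.
  split.
  - by move=> p [hp <-]; have [] := decode_halts R0 hp.
  - move=> p q /set_mem[hp _] /set_mem[hq _]; exact: decode_inj R0 hp hq.
  - move=> p [hp yp]; have [q hq Eq] := decode_surj R0 hp.
    by exists q => //; split=> //; have [_ _ <-] := decode_halts R0 hq; rewrite Eq.
have [psi psiE] : exists psi : halting_path B -> halting_path A,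
    forall q, sval (psi q) = decode (sval q).
  have h (q : halting_path B) : halting (decode (sval q)).
    by case: (decode_halts R0 (svalP q)).
  by exists (fun q => exist (fun p => is_true (halting p)) _ (h q)).
(* Decoding goes from [B] to [A]; the bijection asked for is its inverse. *)
have [phi psiK phiK] : bijective psi.
  rewrite -setTT_bijective; split=> //.
  - move=> p q _ _ /(congr1 sval); rewrite !psiE => E; apply: val_inj.
    by apply: decode_inj R0 _ _ E; [case: (p)|case: (q)].
  - move=> [p hp] _; have [q hq Eq] := decode_surj R0 hp.
    by exists (exist _ q hq) => //; apply: val_inj => /=; rewrite psiE.
exists phi; first by exists psi.
move=> p; have [_ w y] := decode_halts R0 (svalP (phi p)).
by rewrite -w -y -psiE phiK.
Qed.

End Simulation.

(** * Local normalization as a single sum over transitions *)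

Lemma tm_sumE (S Q G : finType) (F : Q * G * option S * Q * G * move -> rat)
    (q : Q) (g : G) :
  \sum_(y : option S) \sum_(q' : Q) \sum_(g' : G) \sum_(d : move)
    F (q, g, y, q', g', d) = \sum_(t | t.1.1.1.1 == (q, g)) F t.
Proof.
rewrite !pair_big_dep /= [RHS](reindex_onto
  (fun p : option S * Q * G * move => (q, g, p.1.1.1, p.1.1.2, p.1.2, p.2))
  (fun t => (t.1.1.1.2, t.1.1.2, t.1.2, t.2))) /=; last first.
  by case=> [[[[[? ?] ?] ?] ?] ?] /= /eqP[-> ->].
by apply: eq_big => -[[[? ?] ?] ?]; rewrite ?eqxx.
Qed.

Lemma pda_sumE (S Q G : finType)
    (F : Q * G * option S * Q * option G * option G * option G * option G -> rat)
    (q : Q) (g h : G) :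
  \sum_(y : option S) \sum_(q' : Q)
  \sum_(g1 : option G | can_pop g g1) \sum_(g2 : option G | can_pop h g2)
  \sum_(g3 : option G) \sum_(g4 : option G) F (q, g, y, q', g1, g2, g3, g4) =
  \sum_(t | [&& t.1.1.1.1.1.1 == (q, g), can_pop g t.1.1.1.2 &
                can_pop h t.1.1.2]) F t.
Proof.
rewrite !pair_big_dep /= [RHS](reindex_onto
  (fun p : option S * Q * option G * option G * option G * option G =>
     (q, g, p.1.1.1.1.1, p.1.1.1.1.2, p.1.1.1.2, p.1.1.2, p.1.2, p.2))
  (fun t => (t.1.1.1.1.1.2, t.1.1.1.1.2, t.1.1.1.2, t.1.1.2, t.1.2, t.2)))
  /=; last first.
  by case=> [[[[[[[? ?] ?] ?] ?] ?] ?] ?] /= /and3P[/eqP[-> ->]].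
by apply: eq_big => -[[[[[? ?] ?] ?] ?] ?]; rewrite ?eqxx //= !andbT.
Qed.

Lemma can_pop_head (G : eqType) (g : G) (x : option G) (s s' : seq G) :
  pop x (g :: s) = Some s' -> can_pop g x.
Proof. by case: x => //= a; case: ifP. Qed.

(** Places an executable transition in the index set of the normalizing sum. The second stack may be
    empty, hence the clause relative to a top [h]. *)
Lemma pda_step_possible (S : finType) (P : twoPDA S) (d d' : pda_config P)
    (T : pda_trans P) : pda_step d T = Some d' ->
  exists2 g, ohead (pdac_stack1 d) = Some g &
    [/\ T.1.1.1.1.1.1 = (pdac_state d, g), can_pop g T.1.1.1.2 &
        forall h s2, pdac_stack2 d = h :: s2 -> can_pop h T.1.1.2].
Proof.
case: T => [[[[[[[q g] y] q'] g1] g2] g3] g4] /=.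
case: ifP => // /andP[/eqP -> /eqP].
case: (pdac_stack1 d) => //= a s1 [->].
case E1: (pop g1 _) => [s1'|//]; case E2: (pop g2 _) => [s2'|//] _.
exists g => //; split=> //; first exact: can_pop_head E1.
by move=> h s2 Es; move: E2; rewrite Es => /can_pop_head.
Qed.

(** * Simulating a Turing machine by a 2PDA *)

Section TMtoPDA.
Variables (S : finType) (M : QPTM S).

(* The scanned cell is kept in the state; the stacks hold the two half-tapes,
   with [None] as bottom symbol standing for the infinitely many blanks below.
   All halting configurations share the state [None]. *)
Local Notation cell := (option (tm_sym M)).
Local Notation mode := (option (tm_state M * tm_sym M)).
Local Notation trans :=
  (mode * cell * option S * mode *
   option cell * option cell * option cell * option cell)%type.

Definition enter (q : tm_state M) (x : tm_sym M) : mode :=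
  if q == tm_final M then None else Some (q, x).

(** The bottom symbol stands for infinitely many blanks, so popping it must put it back. *)
Definition repush (g : cell) : option cell :=
  if g is None then Some None else None.

(* A move without displacement into the final state pushes the written symbol,
   lest distinct transitions of the machine be merged. *)
Definition sim_trans (g h : cell) (t : tm_trans M) : trans :=
  let: (q, x, y, q', x', d) := t in
  match d with
  | MoveN => (Some (q, x), g, y, enter q' x', None, None,
              if q' == tm_final M then Some (Some x') else None, None)
  | MoveR => (Some (q, x), g, y, enter q' (odflt (tm_blank M) g),
              Some g, None, repush g, Some (Some x'))
  | MoveL => (Some (q, x), g, y, enter q' (odflt (tm_blank M) h),
              None, Some h, Some (Some x'), repush h)
  end.

(** Both stack tops are recovered from [T] itself: the second is what a left move pops, and the
    other moves ignore it, so the default is harmless there. *)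
Definition sim_dec (T : trans) : option (tm_trans M) :=
  [pick t | sim_trans T.1.1.1.1.1.1.2 (odflt None T.1.1.2) t == T].

Lemma enter_inj q1 q2 x1 x2 : enter q1 x1 = enter q2 x2 -> q1 = q2.
Proof.
rewrite /enter; case: eqP => [->|_]; case: eqP => [->|_] //.
by case.
Qed.

(** The pops reveal the direction. The written symbol is found in a push or, for a move without
    displacement into a non-final state, in the target mode. *)
Lemma sim_trans_inj g h : injective (sim_trans g h).
Proof.
move=> [[[[[q1 x1] y1] q1'] x1'] d1] [[[[[q2 x2] y2] q2'] x2'] d2].
case: d1; case: d2 => //= -[-> -> -> E].
- by move=> ->; rewrite (enter_inj E).
- by move=> ->; rewrite (enter_inj E).
- have Eq := enter_inj E; subst q2'.
  case: ifP E => fq; first by move=> _ [->].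
  by rewrite /enter fq => -[->].
Qed.

Lemma sim_trans_top g h t : (sim_trans g h t).1.1.1.1.1.1.2 = g.
Proof. by case: t => [[[[[? ?] ?] ?] ?] []]. Qed.

Lemma sim_trans_odflt g h t :
  sim_trans g (odflt None (sim_trans g h t).1.1.2) t = sim_trans g h t.
Proof. by case: t => [[[[[? ?] ?] ?] ?] []]. Qed.

Lemma sim_transK g h : pcancel (sim_trans g h) sim_dec.
Proof.
move=> t; rewrite /sim_dec sim_trans_top; case: pickP => [u /eqP E|/(_ t)].
  congr Some; apply: (@sim_trans_inj g h); move: E.
  case: u => [[[[[? ?] ?] ?] ?] []] //=.
  by case: t => [[[[[? ?] ?] ?] ?] []].
by rewrite sim_trans_odflt eqxx.
Qed.

Lemma sim_decK T t h : sim_dec T = Some t -> can_pop h T.1.1.2 ->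
  T = sim_trans T.1.1.1.1.1.1.2 h t.
Proof.
rewrite /sim_dec; case: pickP => // u /eqP E [<-] {t}.
rewrite -{1 2}E; case: u {E} => [[[[[? ?] ?] ?] ?] []] //=.
by move=> /eqP ->.
Qed.

(** The halting mode [None] must be normalized too; it gets a dummy loop of weight 1, which is never
    run because its source is final. *)
Definition sim_weight (T : trans) : rat :=
  if T.1.1.1.1.1.1.1 is None
  then (T == (None, T.1.1.1.1.1.1.2, None, None, None, None, None, None))%:R
  else if sim_dec T is Some t then weight (t : action (QPTM_model M)) else 0.

Lemma sim_weight_ge0 T : 0 <= sim_weight T.
Proof.
rewrite /sim_weight; case: (T.1.1.1.1.1.1.1) => [_|]; last exact: ler0n.
case: sim_dec => // -[[[[[? ?] ?] ?] ?] ?]; exact: tm_delta_ge0.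
Qed.

Lemma sim_weight_sum1 (s : mode) (g h : cell) :
  \sum_(T | [&& T.1.1.1.1.1.1 == (s, g), can_pop g T.1.1.1.2 &
                can_pop h T.1.1.2]) sim_weight T = 1.
Proof.
case: s => [[q x]|]; last first.
  rewrite (bigD1 (None, g, None, None, None, None, None, None)) ?eqxx //=.
  rewrite {1}/sim_weight /= eqxx big1 ?addr0 // => T.
  case/andP=> /and3P[/eqP ET _ _]; rewrite /sim_weight ET /=.
  by move=> /negPf ->.
(* Undecodable transitions have weight 0; the others are reindexed along [sim_trans g h], which
   turns the sum into the normalization of [M] at [(q, x)]. *)
rewrite (bigID (fun T => isSome (sim_dec T))) /= [X in _ + X]big1 ?addr0.
  rewrite (reindex_omap (sim_trans g h) (@sim_dec)); last first.
    move=> T /andP[/and3P[/eqP ET _ hT]]; case E: sim_dec => [t|] // _.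
    by rewrite [in RHS](sim_decK E hT) ET.
  rewrite -[RHS](tm_delta_sum1 q x).
  rewrite (tm_sumE (fun t => weight (t : action (QPTM_model M)))).
  apply: eq_big => t.
    rewrite sim_transK eqxx !andbT.
    by case: t => [[[[[q1 x1] y1] q'] x'] []] /=;
       rewrite ?eqxx ?andbT !xpair_eqE ?eqxx ?andbT.
  case/andP=> /andP[/and3P[/eqP ET _ _] _] _.
  by rewrite /sim_weight ET sim_transK.
move=> T /andP[/and3P[/eqP ET _ _]].
by rewrite /sim_weight ET /=; case: sim_dec.
Qed.

Lemma sim_delta_sum1 (s : mode) (g h : cell) :
  \sum_(y : option S) \sum_(s' : mode)
  \sum_(g1 : option cell | can_pop g g1) \sum_(g2 : option cell | can_pop h g2)
  \sum_(g3 : option cell) \sum_(g4 : option cell)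
    sim_weight (s, g, y, s', g1, g2, g3, g4) = 1.
Proof. by rewrite pda_sumE sim_weight_sum1. Qed.

Definition pda_of_tm : twoPDA S :=
  @MkTwoPDA S _ _ (None : cell)
    (fun s g y s' g1 g2 g3 g4 => sim_weight (s, g, y, s', g1, g2, g3, g4))
    (enter (tm_init M) (tm_blank M)) None
    (fun _ _ _ _ _ _ _ _ => sim_weight_ge0 _) sim_delta_sum1.

(** Past the end of [l], [nth] returns the blank, in accordance with the meaning of the bottom
    symbol. Trailing blanks in [l] are allowed, so [s] is not determined by [f]. *)
Definition half_tape (f : nat -> tm_sym M) (s : seq cell) : Prop :=
  exists2 l, s = rcons (map Some l) None & forall n, f n = nth (tm_blank M) l n.

Lemma half_tape_ext f1 f2 s : f1 =1 f2 -> half_tape f1 s -> half_tape f2 s.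
Proof. by move=> E [l -> fl]; exists l => // n; rewrite -E. Qed.

Lemma half_tape_pop f s : half_tape f s -> exists h s',
  [/\ s = h :: s', odflt (tm_blank M) h = f 0%N &
      half_tape (fun n => f n.+1) (push (repush h) s')].
Proof.
case=> -[|a l] -> fl.
  exists None, [::]; split; rewrite ?fl //.
  by exists [::] => // n; rewrite fl !nth_nil.
exists (Some a), (rcons (map Some l) None); split; rewrite ?fl //.
by exists l => // n; rewrite fl.
Qed.

Lemma half_tape_push f a s : half_tape f s ->
  half_tape (fun n => if n is m.+1 then f m else a) (Some a :: s).
Proof.
by case=> l -> fl; exists (a :: l) => // -[|n] //=.
Qed.

(** Cell [n] of a half-tape is [n + 1] away from the head. The stacks are unconstrained in the final
    state, since entering it without displacement pushes an extra symbol. *)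
Definition tm_pda_rel (c : tm_config M) (d : pda_config pda_of_tm) : Prop :=
  pdac_state d = enter (tmc_state c) (tmc_tape c (tmc_head c)) /\
  (tmc_state c != tm_final M ->
     half_tape (fun n => tmc_tape c (tmc_head c + n.+1%:Z)) (pdac_stack1 d) /\
     half_tape (fun n => tmc_tape c (tmc_head c - n.+1%:Z)) (pdac_stack2 d)).

Lemma sim_step c d t : tm_pda_rel c d -> tmc_state c != tm_final M ->
  t.1.1.1.1 = (tmc_state c, tmc_tape c (tmc_head c)) ->
  exists g h s1 s2 c' d', [/\ pdac_stack1 d = g :: s1, pdac_stack2 d = h :: s2,
    tm_step c t = Some c', @pda_step S pda_of_tm d (sim_trans g h t) = Some d' &
    tm_pda_rel c' d'].
Proof.
case: c d => q i f [s s1 s2] [/= -> ] rel nfin; have [rel1 rel2] := rel nfin.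
case: t => [[[[[q0 x0] y] q'] x'] dir] /= [-> ->] {rel}.
have [g [s1' [E1 gE rel1']]] := half_tape_pop rel1; subst s1.
have [h [s2' [E2 hE rel2']]] := half_tape_pop rel2; subst s2.
exists g, h, s1', s2'; rewrite !eqxx /=.
have enterE : enter q (f i) = Some (q, f i) by rewrite /enter (negPf nfin).
case: dir; eexists; eexists; split; try reflexivity.
1,3,5: by rewrite /= enterE !eqxx /= ?eqxx.
- rewrite /tm_pda_rel /=; split; first by rewrite ifN ?hE //; lia.
  move=> _; split.
    apply: half_tape_ext (half_tape_push x' rel1) => -[|n] /=.
      by rewrite ifT //; lia.
    by rewrite ifN; [congr f|]; lia.
  apply: half_tape_ext rel2' => n; rewrite /= ifN; [congr f|]; lia.
- rewrite /tm_pda_rel /=; split; first by rewrite ifN ?gE //; lia.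
  move=> _; split.
    by apply: half_tape_ext rel1' => n; rewrite /= ifN; [congr f|]; lia.
  apply: half_tape_ext (half_tape_push x' rel2) => -[|n] /=.
    by rewrite ifT //; lia.
  by rewrite ifN; [congr f|]; lia.
- rewrite /tm_pda_rel /= eqxx; split=> // /negPf ->; split.
    by apply: half_tape_ext rel1 => n; rewrite /= ifN //; lia.
  by apply: half_tape_ext rel2 => n; rewrite /= ifN //; lia.
Qed.

Lemma tm_pda_matching c d : tm_pda_rel c d ->
  @matching S (QPTM_model M) (twoPDA_model pda_of_tm) sim_dec tm_pda_rel c d.
Proof.
move=> rel; have [Es rels] := rel.
have [fc|nfc] := boolP (tmc_state c == tm_final M).
  by apply: BothFinal => //=; rewrite Es /enter fc.
have fd : enter (tmc_state c) (tmc_tape c (tmc_head c)) =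
    Some (tmc_state c, tmc_tape c (tmc_head c)) by rewrite /enter (negPf nfc).
have weightE T : @weight S (twoPDA_model pda_of_tm) T = sim_weight T.
  by case: T => [[[[[[[? ?] ?] ?] ?] ?] ?] ?].
have [rel1 rel2] := rels nfc.
have [g [s1 [E1 _ _]]] := half_tape_pop rel1.
have [h [s2 [E2 _ _]]] := half_tape_pop rel2.
(* Nonzero weight forces [T] to decode, and its pop fits the actual top [h], so [T] is the image of
   a transition of [M] from the current state and symbol; no dead end arises in this direction. *)
have decT T d' : @enabled S (twoPDA_model pda_of_tm) d T d' ->
    exists t, [/\ sim_dec T = Some t, T = sim_trans g h t &
      t.1.1.1.1 = (tmc_state c, tmc_tape c (tmc_head c))].
  case=> _; rewrite weightE => wT /pda_step_possible[g' Eg].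
  move: Eg; rewrite E1 => -[<-] [ET _ /(_ _ _ E2) hT].
  move: wT; rewrite /sim_weight ET Es fd; case E: sim_dec => [t|//] _.
  have ET' := sim_decK E hT; rewrite ET /= in ET'.
  exists t; split=> //; move: ET; rewrite ET' Es fd.
  by case: t {E ET'} => [[[[[? ?] ?] ?] ?] []] /= [-> ->].
apply: BothStep => //=.
- by rewrite Es fd.
- move=> T d' en; right; have [t [Et ET Esrc]] := decT _ _ en.
  have [g' [h' [s1' [s2' [c' [d1 [E1' E2' stc std rel']]]]]]] :=
    sim_step rel nfc Esrc.
  move: E1' E2'; rewrite E1 E2 => -[? _] [? _]; subst g' h'.
  have wE : @weight S (twoPDA_model pda_of_tm) T = @weight S (QPTM_model M) t.
    by rewrite weightE /sim_weight Et ET; case: (t) => [[[[[? ?] ?] ?] ?] []].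
  have [_ wT stT] := en; move: stT; rewrite /= ET std => -[<-].
  exists t, c'; split; rewrite -?ET //.
    by rewrite ET; case: (t) => [[[[[? ?] ?] ?] ?] []].
  by split; [exact: nfc|rewrite -wE|exact: stc].
- move=> t c' [_ wt stc].
  have Esrc : t.1.1.1.1 = (tmc_state c, tmc_tape c (tmc_head c)).
    move: stc; case: t {wt} => [[[[[? ?] ?] ?] ?] ?] /=.
    by case: ifP => // /andP[/eqP -> /eqP ->].
  have [g' [h' [s1' [s2' [c1 [d' [E1' E2' stc1 std rel']]]]]]] :=
    sim_step rel nfc Esrc.
  move: E1' E2'; rewrite E1 E2 => -[? _] [? _]; subst g' h'.
  exists (sim_trans g h t), d'; split; first exact: sim_transK.
    split=> //=; first by rewrite Es fd.
    rewrite -[X in X != 0]/(@weight S (twoPDA_model pda_of_tm) _) weightE.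
    by rewrite /sim_weight sim_transK; case: (t) wt => [[[[[? ?] ?] ?] ?] []].
  by move: stc; rewrite /= stc1 => -[<-].
- move=> T1 T2 d1 d2 /decT[t1 [E3 -> _]] /decT[t2 [E4 -> _]].
  by rewrite !sim_transK => -[->].
Qed.

Lemma tm_pda_strongly_equivalent (K : realType) :
  strongly_equivalent K (QPTM_model M) (twoPDA_model pda_of_tm).
Proof.
apply: (@simulation_strongly_equivalent S (QPTM_model M)
  (twoPDA_model pda_of_tm) sim_dec tm_pda_rel).
  by move=> c d /tm_pda_matching m; exists d => //; exact: silent_refl.
split=> //= _; split; exists [::] => // n; by rewrite nth_nil.
Qed.

End TMtoPDA.

(** * Simulating a 2PDA by a Turing machine *)

(** A round visits the phases from [Home] to [PushRight] in this order; [Init] joins at [PushLeft].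
    [Sample] also performs the second pop, and the later phases carry the transition still to be
    completed. *)
Inductive phase (Q G T : Type) : Type :=
| Init
| Home of Q
| SeekLeft of Q & G
| Sample of Q & G
| PushLeft of T
| SeekRight of T
| PopRight of T
| PushRight of T.

Arguments Init {Q G T}.
Arguments Home {Q G T}.
Arguments SeekLeft {Q G T}.
Arguments Sample {Q G T}.
Arguments PushLeft {Q G T}.
Arguments SeekRight {Q G T}.
Arguments PopRight {Q G T}.
Arguments PushRight {Q G T}.

Definition phase_code (Q G T : Type) (s : phase Q G T) :
    option (Q + bool * (Q * G) + bool * bool * T) :=
  match s with
  | Init => None
  | Home q => Some (inl (inl q))
  | SeekLeft q g => Some (inl (inr (true, (q, g))))
  | Sample q g => Some (inl (inr (false, (q, g))))
  | PushLeft t => Some (inr (true, true, t))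
  | SeekRight t => Some (inr (true, false, t))
  | PopRight t => Some (inr (false, true, t))
  | PushRight t => Some (inr (false, false, t))
  end.

Definition phase_decode (Q G T : Type)
    (x : option (Q + bool * (Q * G) + bool * bool * T)) : phase Q G T :=
  match x with
  | None => Init
  | Some (inl (inl q)) => Home q
  | Some (inl (inr (true, (q, g)))) => SeekLeft q g
  | Some (inl (inr (false, (q, g)))) => Sample q g
  | Some (inr (true, true, t)) => PushLeft t
  | Some (inr (true, false, t)) => SeekRight t
  | Some (inr (false, true, t)) => PopRight t
  | Some (inr (false, false, t)) => PushRight t
  end.

Lemma phase_codeK (Q G T : Type) :
  cancel (@phase_code Q G T) (@phase_decode Q G T).
Proof. by case. Qed.

HB.instance Definition _ (Q G T : finType) :=
  Finite.copy (phase Q G T) (can_type (@phase_codeK Q G T)).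

(** * Two stacks on one two-way infinite tape *)

Section StacksTape.
Variable G : eqType.
Implicit Types (a : G) (s : seq G).

(** Stacks are listed from the top, but their bottoms lie next to the origin, hence [rev]. *)
Definition stack_cell s (n : nat) : option (option G) :=
  nth None [seq Some (Some a) | a <- rev s] n.

Definition stacks_tape (s1 s2 : seq G) (i : int) : option (option G) :=
  match i with
  | Posz 0 => Some None
  | Posz n.+1 => stack_cell s1 n
  | Negz n => stack_cell s2 n
  end.

Lemma stack_cell_cons a s n :
  stack_cell (a :: s) n = if n == size s then Some (Some a) else stack_cell s n.
Proof.
rewrite /stack_cell rev_cons map_rcons nth_rcons size_map size_rev.
by case: ltngtP => // h; rewrite nth_default // size_map size_rev ltnW.
Qed.

Lemma stack_cell_blank s : stack_cell s (size s) = None.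
Proof. by rewrite /stack_cell nth_default // size_map size_rev. Qed.

Lemma stack_cell_neq_blank s n : (n < size s)%N -> stack_cell s n != None.
Proof.
elim: s => // a s IH; rewrite stack_cell_cons /= ltnS leq_eqVlt.
by case: eqP => //= _; exact: IH.
Qed.

Lemma stacks_tape_neq_blank s1 s2 (i : int) :
  - (size s2)%:Z <= i <= (size s1)%:Z -> stacks_tape s1 s2 i != None.
Proof.
case: i => [[|n]|n] h //=; apply: stack_cell_neq_blank; move: h;
  rewrite ?NegzE; lia.
Qed.

Lemma stacks_tape_top1 a s1 s2 :
  stacks_tape (a :: s1) s2 (size (a :: s1))%:Z = Some (Some a).
Proof. by rewrite /= stack_cell_cons eqxx. Qed.

(** For an empty stack the position is the origin, whose mark [Some None] is also [Some (ohead
    [::])]. *)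
Lemma stacks_tape_top2 s1 s2 :
  stacks_tape s1 s2 (- (size s2)%:Z) = Some (ohead s2).
Proof. by case: s2 => //= a s2; rewrite stack_cell_cons eqxx. Qed.

Lemma stacks_tape_end1 s1 s2 : stacks_tape s1 s2 (size s1).+1%:Z = None.
Proof. exact: stack_cell_blank. Qed.

Lemma stacks_tape_end2 s1 s2 : stacks_tape s1 s2 (- (size s2).+1%:Z) = None.
Proof. exact: stack_cell_blank. Qed.

Lemma stacks_tape_push1 x s1 s2 :
  (fun i => if i == (size s1).+1%:Z then omap Some x else stacks_tape s1 s2 i) =
  stacks_tape (push x s1) s2.
Proof.
apply/funext => i; case: x => [a|] /=; last first.
  by case: eqP => // ->; rewrite stacks_tape_end1.
case: i => [[|n]|n] //=.
by rewrite stack_cell_cons eqz_nat eqSS.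
Qed.

Lemma stacks_tape_push2 x s1 s2 :
  (fun i => if i == - (size s2).+1%:Z then omap Some x else stacks_tape s1 s2 i) =
  stacks_tape s1 (push x s2).
Proof.
apply/funext => i; case: x => [a|] /=; last first.
  by case: eqP => // ->; rewrite stacks_tape_end2.
case: i => [[|n]|n] //=.
by rewrite stack_cell_cons.
Qed.

Lemma stacks_tape_pop1 a s1 s2 :
  (fun i => if i == (size s1).+1%:Z then None else stacks_tape (a :: s1) s2 i) =
  stacks_tape s1 s2.
Proof.
rewrite -(stacks_tape_push1 (Some a)); apply/funext => i /=.
by case: eqP => // ->; rewrite stacks_tape_end1.
Qed.

Lemma stacks_tape_pop2 a s1 s2 :
  (fun i => if i == - (size s2).+1%:Z then None else stacks_tape s1 (a :: s2) i) =
  stacks_tape s1 s2.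
Proof.
rewrite -(stacks_tape_push2 (Some a)); apply/funext => i /=.
by case: eqP => // ->; rewrite stacks_tape_end2.
Qed.

Lemma tape_rewrite (X : Type) (f : int -> X) (j : int) :
  (fun i => if i == j then f j else f i) = f.
Proof. by apply/funext => i; case: eqP => [->|]. Qed.

End StacksTape.

(** * Transition weights of the simulating Turing machine *)

Section PDAtoTM.
Variables (S : finType) (P : twoPDA S).
Local Notation trans := (pda_trans P).
Local Notation state := (phase (pda_state P) (pda_sym P) trans).
(* [None] is blank and [Some None] marks the origin. *)
Local Notation sym := (option (option (pda_sym P))).
Local Notation outcome := (option S * state * sym * move)%type.

Local Notation source t := t.1.1.1.1.1.1.
Local Notation yield t := t.1.1.1.1.1.2.
Local Notation target t := t.1.1.1.1.2.
Local Notation pop1 t := t.1.1.1.2.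
Local Notation pop2 t := t.1.1.2.
Local Notation push1 t := t.1.2.
Local Notation push2 t := t.2.

Definition pda_weight (t : trans) : rat := @weight S (twoPDA_model P) t.

(** A fictitious transition: carrying it out on two empty stacks builds the initial configuration of
    [P]. *)
Definition bottom_trans : trans :=
  (pda_init P, pda_bot P, None, pda_init P, None, None,
   Some (pda_bot P), Some (pda_bot P)).

(** [PopRight] leaves the head on the first free cell whether or not it pops, and [PushRight] leaves
    it on the new top. The final clause loops in place, which normalizes the remaining pairs and
    makes jammed configurations dead. *)
Definition det_step (s : state) (x : sym) : outcome :=
  match s, x with
  | Init, None => (None, PushLeft bottom_trans, Some None, MoveL)
  | Home q, Some (Some g) => (None, SeekLeft q g, x, MoveL)
  | SeekLeft q g, Some _ => (None, SeekLeft q g, x, MoveL)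
  | SeekLeft q g, None => (None, Sample q g, None, MoveR)
  | PushLeft t, None => (None, SeekRight t, omap Some (push2 t), MoveR)
  | SeekRight t, Some _ => (None, SeekRight t, x, MoveR)
  | SeekRight t, None => (None, PopRight t, None, MoveL)
  | PopRight t, Some _ =>
      if pop1 t is Some _ then (None, PushRight t, None, MoveN)
      else (None, PushRight t, x, MoveR)
  | PushRight t, None =>
      (None, Home (target t), omap Some (push1 t),
       if push1 t is Some _ then MoveN else MoveL)
  | _, _ => (None, s, x, MoveN)
  end.

(* At the origin the second stack is empty; the bottom symbol is then used as a
   fictitious top to make the weights sum to 1, and a transition popping it gets
   stuck in the state [PushLeft], which only acts on a blank. *)
Definition possible (q : pda_state P) (g : pda_sym P)
    (h : option (pda_sym P)) (t : trans) : bool :=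
  [&& source t == (q, g), can_pop g (pop1 t) &
      can_pop (odflt (pda_bot P) h) (pop2 t)].

(** The head ends on the first free cell of the second stack, as [PushLeft] expects, except for a
    pop at the origin, where the mark is kept. *)
Definition sample_outcome (h : option (pda_sym P)) (t : trans) : outcome :=
  if pop2 t is Some _
  then (yield t, PushLeft t, if h is Some _ then None else Some None, MoveN)
  else (yield t, PushLeft t, Some h, MoveL).

(** The sum has at most one term, since [PushLeft t] records [t]; written as a sum, it is normalized
    by partitioning the transitions according to their outcome. *)
Definition outcome_weight (s : state) (x : sym) (o : outcome) : rat :=
  match s, x with
  | Sample q g, Some h =>
      \sum_(t | possible q g h t && (sample_outcome h t == o)) pda_weight t
  | _, _ => (o == det_step s x)%:R
  end.

Lemma pda_weight_ge0 t : 0 <= pda_weight t.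
Proof. by case: t => [[[[[[[? ?] ?] ?] ?] ?] ?] ?]; exact: pda_delta_ge0. Qed.

Lemma outcome_weight_ge0 s x o : 0 <= outcome_weight s x o.
Proof.
case: s => *; rewrite /outcome_weight; try exact: ler0n.
by case: x => *; [apply: sumr_ge0 => t _; exact: pda_weight_ge0|exact: ler0n].
Qed.

Lemma outcome_weight_sum1 s x : \sum_o outcome_weight s x o = 1.
Proof.
have det : \sum_o (o == det_step s x)%:R = 1 :> rat.
  by rewrite (bigD1 (det_step s x)) //= eqxx big1 ?addr0 // => o /negPf ->.
case: s det => //= q g; case: x => //= h _.
rewrite -(partition_big (sample_outcome h) predT) //=.
rewrite -[RHS](pda_delta_sum1 q g (odflt (pda_bot P) h)).
by rewrite (pda_sumE pda_weight).
Qed.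

Lemma tm_delta_of_pda_sum1 s x :
  \sum_(y : option S) \sum_(s' : state) \sum_(x' : sym) \sum_(d : move)
    outcome_weight s x (y, s', x', d) = 1.
Proof.
rewrite !pair_big_dep /= -[RHS](outcome_weight_sum1 s x).
by apply: eq_bigr => -[[[? ?] ?] ?].
Qed.

Definition tm_of_pda : QPTM S :=
  @MkQPTM S _ _ (None : sym)
    (fun s x y s' x' d => outcome_weight s x (y, s', x', d))
    Init (Home (pda_final P))
    (fun _ _ _ _ _ _ => outcome_weight_ge0 _ _ _) tm_delta_of_pda_sum1.

(** * Forced runs and correctness of the simulating machine *)

Local Notation TM := (QPTM_model tm_of_pda).
Local Notation PDA := (twoPDA_model P).
Local Notation conf := (@TMConfig S tm_of_pda).

Definition sampled_trans (t : tm_trans tm_of_pda) : option trans :=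
  let: (s, x, y, s', x', d) := t in
  match s, s' with
  | Sample _ _, PushLeft u => Some u
  | _, _ => None
  end.

Local Notation silent := (@silent S PDA TM sampled_trans).

Definition sampling (s : state) (x : sym) : bool :=
  match s, x with Sample _ _, Some _ => true | _, _ => false end.

Lemma tm_enabledP s i f (t : tm_trans tm_of_pda) (c : tm_config tm_of_pda) :
  @enabled S TM (conf s i f) t c ->
  exists y s' x' d, [/\ t = (s, f i, y, s', x', d),
    outcome_weight s (f i) (y, s', x', d) != 0 &
    c = conf s' (move_head d i) (fun j => if j == i then x' else f j)].
Proof.
case: t => [[[[[s0 x] y] s'] x'] d] [_ /= w].
case: ifP => // /andP[/eqP Es /eqP Ex] [<-]; subst s0 x.
by exists y, s', x', d.
Qed.

Lemma det_silent_step s i f s' x' d :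
  s != Home (pda_final P) -> ~~ sampling s (f i) ->
  det_step s (f i) = (None, s', x', d) ->
  @silent_step S PDA TM sampled_trans (conf s i f) (s, f i, None, s', x', d)
    (conf s' (move_head d i) (fun j => if j == i then x' else f j)).
Proof.
move=> nf ns E.
have wE o : outcome_weight s (f i) o = (o == (None, s', x', d))%:R.
  by rewrite -E; move: ns; case: s {nf E} => //= q g; case: (f i).
split=> //.
- by split; rewrite //= ?eqxx // wE eqxx.
- move=> t c /tm_enabledP[y [s1 [x1 [d1 [-> + _]]]]].
  by rewrite wE pnatr_eq0 eqb0 negbK => /eqP[-> -> -> ->].
- by rewrite /= wE eqxx.
(* A [Sample] state reading a blank loops in [Sample], so it never looks like a sampling into
   [PushLeft]. *)
- move: ns E {wE nf}; case: s => //= q g; case: (f i) => //= _ [<-] //.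
Qed.

Lemma det_silent s i f x s' x' d i' f' :
  f i = x -> s != Home (pda_final P) -> ~~ sampling s x ->
  det_step s x = (None, s', x', d) -> move_head d i = i' ->
  (fun j => if j == i then x' else f j) = f' ->
  silent (conf s i f) (conf s' i' f').
Proof.
move=> <- nf ns E <- <-; apply: silent_cons (det_silent_step nf ns E) _.
exact: silent_refl.
Qed.

Lemma det_silent_keep s i f x s' d i' :
  f i = x -> s != Home (pda_final P) -> ~~ sampling s x ->
  det_step s x = (None, s', x, d) -> move_head d i = i' ->
  silent (conf s i f) (conf s' i' f).
Proof.
by move=> <- nf ns E Ei; apply: det_silent E Ei (tape_rewrite _ _).
Qed.

Lemma seek_left q g (f : int -> sym) n i :
  (forall k, (k < n)%N -> f (i - k%:Z) != None) ->
  silent (conf (SeekLeft q g) i f) (conf (SeekLeft q g) (i - n%:Z) f).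
Proof.
elim: n => [|n IH] h; first by rewrite subr0; exact: silent_refl.
apply: silent_trans (IH _) _; first by move=> k kn; apply: h; exact: ltnW.
have := h n (ltnSn n); case E: (f _) => [x|] // _.
by apply: (det_silent_keep E) => //=; lia.
Qed.

Lemma seek_right t (f : int -> sym) n i :
  (forall k, (k < n)%N -> f (i + k%:Z) != None) ->
  silent (conf (SeekRight t) i f) (conf (SeekRight t) (i + n%:Z) f).
Proof.
elim: n => [|n IH] h; first by rewrite addr0; exact: silent_refl.
apply: silent_trans (IH _) _; first by move=> k kn; apply: h; exact: ltnW.
have := h n (ltnSn n); case E: (f _) => [x|] // _.
by apply: (det_silent_keep E) => //=; lia.
Qed.

Definition home (c : pda_config P) : tm_config tm_of_pda :=
  conf (Home (pdac_state c)) (size (pdac_stack1 c))%:Z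
    (stacks_tape (pdac_stack1 c) (pdac_stack2 c)).

(** Only the first pop is assumed: [s2] is the second stack after its pop, already done when
    sampling. *)
Lemma execute t s1 s2 s1' : pop (pop1 t) s1 = Some s1' ->
  silent (conf (PushLeft t) (- (size s2).+1%:Z) (stacks_tape s1 s2))
    (home (PDAConfig (target t) (push (push1 t) s1') (push (push2 t) s2))).
Proof.
move=> E1.
have st1 : silent (conf (PushLeft t) (- (size s2).+1%:Z) (stacks_tape s1 s2))
    (conf (SeekRight t) (- (size s2)%:Z) (stacks_tape s1 (push (push2 t) s2))).
  apply: (det_silent (stacks_tape_end2 _ _)) => //=; last first.
    exact: stacks_tape_push2.
  by lia.
apply: silent_trans st1 _; set s2' := push _ s2.
have sz2 : (size s2 <= size s2')%N by rewrite /s2'; case: (push2 t) => //=; lia.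
have st2 : silent (conf (SeekRight t) (- (size s2)%:Z) (stacks_tape s1 s2'))
    (conf (SeekRight t) (size s1).+1%:Z (stacks_tape s1 s2')).
  (* The walk crosses the cells from [- size s2] to [size s1], origin included; all are nonblank
     whether or not a symbol was just pushed. *)
  rewrite (_ : (size s1).+1%:Z = - (size s2)%:Z + (size s1 + size s2).+1%:Z);
    last by lia.
  by apply: seek_right => k kn; apply: stacks_tape_neq_blank; lia.
have st3 : silent (conf (SeekRight t) (size s1).+1%:Z (stacks_tape s1 s2'))
    (conf (PopRight t) (size s1)%:Z (stacks_tape s1 s2')).
  by apply: (det_silent_keep (stacks_tape_end1 _ _)) => //=; lia.
apply: silent_trans st2 (silent_trans st3 _).
have st4 : silent (conf (PopRight t) (size s1)%:Z (stacks_tape s1 s2'))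
    (conf (PushRight t) (size s1').+1%:Z (stacks_tape s1' s2')).
  case Ep: (pop1 t) E1 => [a|] /=; last first.
    case=> <-; have : stacks_tape s1 s2' (size s1)%:Z != None.
      by apply: stacks_tape_neq_blank; lia.
    case E: (stacks_tape _ _ _) => [x|] // _.
    by apply: (det_silent_keep E) => //=; rewrite ?Ep //=; lia.
  case: s1 {st3} => // b s1; case: eqP => // _ [<-].
  apply: (det_silent (stacks_tape_top1 _ _ _)) => //=; first by rewrite Ep.
    by [].
  exact: stacks_tape_pop1.
apply: silent_trans st4 _.
apply: (det_silent (stacks_tape_end1 _ _)) => //=; last first.
  exact: stacks_tape_push1.
by case: (push1 t) => //=; lia.
Qed.

Lemma initialize :
  silent (start TM) (home (start PDA)).
Proof.
have st1 : silent (start TM)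
    (conf (PushLeft bottom_trans) (- 1%:Z) (stacks_tape [::] [::])).
  apply: (@det_silent _ _ _ None) => //=.
  by apply/funext => -[[|n]|n] //=; rewrite /stack_cell nth_nil.
by apply: silent_trans st1 _; apply: (@execute bottom_trans [::] [::] [::]).
Qed.

Lemma search q g s1 s2 : q != pda_final P ->
  silent (home (PDAConfig q (g :: s1) s2))
    (conf (Sample q g) (- (size s2)%:Z) (stacks_tape (g :: s1) s2)).
Proof.
move=> nf.
have st1 : silent (home (PDAConfig q (g :: s1) s2))
    (conf (SeekLeft q g) (size s1)%:Z (stacks_tape (g :: s1) s2)).
  by apply: (det_silent_keep (stacks_tape_top1 _ _ _)) => //=; lia.
have st2 : silent (conf (SeekLeft q g) (size s1)%:Z (stacks_tape (g :: s1) s2))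
    (conf (SeekLeft q g) (- (size s2).+1%:Z) (stacks_tape (g :: s1) s2)).
  rewrite (_ : - (size s2).+1%:Z = (size s1)%:Z - (size s1 + size s2).+1%:Z);
    last by lia.
  by apply: seek_left => k kn; apply: stacks_tape_neq_blank => /=; lia.
apply: silent_trans st1 (silent_trans st2 _).
by apply: (det_silent_keep (stacks_tape_end2 _ _)) => //=; lia.
Qed.

Lemma det_loop_dead s i f : s != Home (pda_final P) -> ~~ sampling s (f i) ->
  det_step s (f i) = (None, s, f i, MoveN) -> @dead S TM (conf s i f).
Proof.
move=> nf ns E; have := det_silent_step nf ns E.
by rewrite tape_rewrite; exact: silent_loop_dead.
Qed.

Lemma sample_outcome_inj h : injective (sample_outcome h).
Proof.
move=> t1 t2; rewrite /sample_outcome.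
by case: (pop2 t1) (pop2 t2) => [?|] [?|] [].
Qed.

Lemma outcome_weight_sample q g h t : possible q g h t ->
  outcome_weight (Sample q g) (Some h) (sample_outcome h t) = pda_weight t.
Proof.
move=> pt /=; rewrite (big_pred1 t) // => u /=.
by case: (u =P t) => [->|/eqP ut]; rewrite ?pt ?eqxx //
  (inj_eq (@sample_outcome_inj h)) (negPf ut) andbF.
Qed.

Lemma sample_next q g s1 s2 t y s' x' d :
  possible q g (ohead s2) t -> sample_outcome (ohead s2) t = (y, s', x', d) ->
  let next := conf s' (move_head d (- (size s2)%:Z))
    (fun j => if j == - (size s2)%:Z then x' else stacks_tape (g :: s1) s2 j) in
  if pda_step (PDAConfig q (g :: s1) s2) t is Some c' then silent next (home c')
  else @dead S TM next.
Proof.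
case: t => [[[[[[[q0 g0] y0] q'] g1] g2] g3] g4] /and3P[/= /eqP[-> ->]].
move=> cp1 cp2; rewrite !eqxx /=.
(* [can_pop] refers to the true top of the first stack, so only the second pop can fail. *)
have [s1' E1] : exists s1', pop g1 (g :: s1) = Some s1'.
  by case: g1 cp1 => [a|] /= => [/eqP ->|_]; rewrite ?eqxx; eexists.
rewrite E1; case: g2 cp2 => [a|] cp2.
  case: s2 cp2 => [|b s2] /=.
    (* The fictitious top is popped from an empty stack: [P] is stuck, and [PushLeft] loops on the
       origin mark. *)
    move=> _ [_ <- <- <-]; rewrite /= -[Some None]/(stacks_tape (g :: s1) [::] 0).
    by rewrite tape_rewrite; apply: det_loop_dead.
  move=> /eqP -> [_ <- <- <-] /=; rewrite eqxx stacks_tape_pop2.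
  exact: (@execute (q, g, y0, q', g1, Some b, g3, g4) _ s2).
move=> [_ <- <- <-] /=.
rewrite -(stacks_tape_top2 (g :: s1) s2) tape_rewrite.
rewrite (_ : - _ - 1 = - (size s2).+1%:Z); last by lia.
exact: (@execute (q, g, y0, q', g1, None, g3, g4) _ s2).
Qed.

(** The machine need only be on a forced way home, so the relation already holds right after
    sampling. *)
Definition pda_tm_rel (c : pda_config P) (d : tm_config tm_of_pda) : Prop :=
  silent d (home c).

Lemma sample_matching q g s1 s2 : q != pda_final P ->
  @matching S PDA TM sampled_trans pda_tm_rel (PDAConfig q (g :: s1) s2)
    (conf (Sample q g) (- (size s2)%:Z) (stacks_tape (g :: s1) s2)).
Proof.
move=> nf; set c := PDAConfig _ _ _; set d := conf _ _ _.
have sampled b d' : @enabled S TM d b d' -> exists t, [/\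
    sampled_trans b = Some t, possible q g (ohead s2) t,
    b = (let: (y, s', x', m) := sample_outcome (ohead s2) t in
         (Sample q g, Some (ohead s2), y, s', x', m)) &
    if pda_step c t is Some c' then silent d' (home c')
    else @dead S TM d'].
  case/tm_enabledP=> y [s' [x' [m []]]]; rewrite stacks_tape_top2 => -> w ->.
  have [t /andP[pt /eqP Et]] : exists t,
      possible q g (ohead s2) t && (sample_outcome (ohead s2) t == (y, s', x', m)).
    apply/existsP; apply: contraNT w; rewrite negb_exists => /forallP w.
    by rewrite /= big1 // => t; rewrite (negPf (w t)).
  exists t; split=> //; last exact: (sample_next s1 pt Et).
    by move: Et; rewrite /sample_outcome /=; case: (pop2 t) => [?|] [_ <-].
  by rewrite Et.
apply: BothStep => //.
- move=> b d' en; have [t [bt pt Eb]] := sampled _ _ en.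
  case E: (pda_step c t) => [c'|] next; [right|by left].
  exists t, c'; have [_ wb _] := en.
  have w : @weight S TM b = pda_weight t.
    rewrite Eb -(outcome_weight_sample pt).
    by case: (sample_outcome _ _) => [[[? ?] ?] ?].
  split=> //.
    rewrite Eb /sample_outcome.
    by case: (t) => [[[[[[[? ?] ?] ?] ?] [?|]] ?] ?].
  by split=> //; rewrite w in wb.
- move=> t c' [_ wt st].
  have pt : possible q g (ohead s2) t.
    have [g' [<-] [Et cp1 cp2]] := pda_step_possible st.
    rewrite /possible Et eqxx cp1 /=.
    (* On an empty second stack an executable transition pops nothing, hence is compatible with the
       fictitious top. *)
    case Es: s2 cp2 => [|h s2'] /=; last by move=> /(_ _ _ Es).
    move: st; rewrite /c Es; case: (t) => [[[[[[[? ?] ?] ?] ?] [a|]] ?] ?] //=.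
    by case: ifP => //; case: pop.
  case Eo: (sample_outcome (ohead s2) t) => [[[y s'] x'] m].
  have := sample_next s1 pt Eo; rewrite (st : pda_step c t = _) => next.
  exists (Sample q g, Some (ohead s2), y, s', x', m); eexists; split;
    last exact: next.
    by move: Eo; rewrite /sample_outcome /=; case: (pop2 t) => [?|] [_ <-].
  split=> //; last by rewrite /= stacks_tape_top2 !eqxx.
  by have : pda_weight t != 0 := wt; rewrite -(outcome_weight_sample pt) Eo.
- move=> b1 b2 d1 d2 /sampled[t1 [E1 _ Eb1 _]] /sampled[t2 [E2 _ Eb2 _]].
  by rewrite E1 E2 => -[Et]; rewrite Eb1 Eb2 Et.
Qed.

Lemma pda_tm_matching c d : pda_tm_rel c d ->
  exists2 d', silent d d' &
    @matching S PDA TM sampled_trans pda_tm_rel c d'.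
Proof.
move=> rel; have [fc|nfc] := boolP (pdac_state c == pda_final P).
  by exists (home c); [|apply: BothFinal => //=; rewrite (eqP fc)].
case: c nfc rel => q [|g s1] s2 /= nf rel; last first.
  exists (conf (Sample q g) (- (size s2)%:Z) (stacks_tape (g :: s1) s2)).
    exact: silent_trans rel (search _ _ _ _).
  exact: sample_matching.
(* With an empty first stack no transition of [P] applies, and [Home] loops on the origin mark. *)
exists (home (PDAConfig q [::] s2)) => //; apply: BothDead.
  case=> [|t p] //; apply/negP => /halts_consP[c' [_ _ /pda_step_possible]].
  by case.
apply: det_loop_dead => //.
Qed.

Lemma pda_tm_strongly_equivalent (K : realType) : strongly_equivalent K PDA TM.
Proof.
apply: (@simulation_strongly_equivalent S PDA TM sampled_trans pda_tm_rel).
  exact: pda_tm_matching.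
exact: initialize.
Qed.

End PDAtoTM.

Theorem theorem3p1 (R : realType) (Sigma : finType)
    (Sigma_nonempty : (0 < #|Sigma|)%N) :
  (forall M : QPTM Sigma, exists P : twoPDA Sigma,
     strongly_equivalent R (QPTM_model M) (twoPDA_model P)) /\
  (forall P : twoPDA Sigma, exists M : QPTM Sigma,
     strongly_equivalent R (twoPDA_model P) (QPTM_model M)).
Proof.
split=> [M|P].
  by exists (pda_of_tm M); exact: tm_pda_strongly_equivalent.
by exists (tm_of_pda P); exact: pda_tm_strongly_equivalent.
Qed.
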